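(* Let $r_{2,5}(n)=\operatorname{CT}_{X_1,\ldots,X_5}\big(\sigma_2(Y_1,\ldots,Y_5)\big)^{n}$ with $Y_j=X_j+X_j^{-1}$. Then $r_{2,5}(n)$ satisfies a linear recurrence of order $7$: there exist polynomials $h_0(n),\ldots,h_7(n)\in\mathbb{Z}[n]$ of degree $12$ such that $\sum_{j=0}^{7}h_j(n)\,r_{2,5}(n+j)=0$ for all $n\ge 0$. Accordingly, $R_{2,5}(z)=\sum_{n\ge0}r_{2,5}(n)z^n$ satisfies a linear differential equation (in $\vartheta=z\frac{d}{dz}$ with polynomial coefficients in $z$) of order $19$ and degree $7$.
   Context: $\sigma_2(y_1,\ldots,y_5)=\sum_{1\le a<b\le5}y_ay_b$; $\operatorname{CT}$ denotes the constant term (coefficient of $X_1^0\cdots X_5^0$) of a Laurent polynomial. A differential equation $\sum_{k=0}^K u_k(z)\vartheta^k F=0$ with $u_k\in\mathbb{Q}[z]$, $u_K\ne0$, has order $K$ and degree equal to the maximal degree of the $u_k$. *)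

(* Defs.v *)
From mathcomp Require Import all_boot all_order all_algebra.
Set Implicit Arguments. Unset Strict Implicit. Unset Printing Implicit Defensive.
Import Order.TTheory GRing.Theory Num.Theory.
Local Open Scope ring_scope.

(* Laurent polynomials in the 5 variables X_0..X_4 with integer coefficients,
   represented as finite formal sums: a list of terms (e, c) standing for the
   monomial c * X_0^(e_0) * ... * X_4^(e_4), where the exponent vector e is a
   list of 5 integers.  The represented Laurent polynomial is the sum of the
   terms (repetitions allowed); addition is concatenation, multiplication is
   distribution (exponent vectors add componentwise, coefficients multiply). *)
Definition expo := seq int.
Definition lpoly := seq (expo * int).

Definition eadd (e f : expo) : expo := [seq x.1 + x.2 | x <- zip e f].
Definition ezero : expo := nseq 5 0.

Definition ladd (p q : lpoly) : lpoly := p ++ q.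
Definition lmul (p q : lpoly) : lpoly :=
  [seq (eadd s.1 t.1, s.2 * t.2) | s : expo * int <- p, t : expo * int <- q].
Definition lone : lpoly := [:: (ezero, 1)].
Definition lpow (p : lpoly) (n : nat) : lpoly := iter n (lmul p) lone.

Definition CT (p : lpoly) : int := \sum_(t <- p | t.1 == ezero) t.2.

Definition X (j : nat) : lpoly := [:: ([seq (i == j)%:Z | i <- iota 0 5], 1)].
Definition Xinv (j : nat) : lpoly := [:: ([seq - (i == j)%:Z | i <- iota 0 5], 1)].
Definition Y (j : nat) : lpoly := ladd (X j) (Xinv j).

Definition sigma2Y : lpoly :=
  foldr ladd [::]
    [seq lmul (Y ab.1) (Y ab.2) |
       ab : nat * nat <- [seq (a, b) | a <- iota 0 5, b <- iota 0 5] & (ab.1 < ab.2)%N].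

Definition r25 (n : nat) : int := CT (lpow sigma2Y n).

Definition fps := nat -> rat.
Definition R25 : fps := fun n => (r25 n)%:~R.
Definition theta (F : fps) : fps := fun n => n%:R * F n.
Definition pmul (u : {poly rat}) (F : fps) : fps :=
  fun m => \sum_(i < m.+1) u`_i * F (m - i)%N.
Definition diffop_apply (K : nat) (u : 'I_K.+1 -> {poly rat}) (F : fps) : fps :=
  fun m => \sum_(k < K.+1) pmul (u k) (iter k theta F) m.
Definition diffop_degree (K : nat) (u : 'I_K.+1 -> {poly rat}) : nat :=
  \max_(k < K.+1) (size (u k)).-1.

(* Main.v *)
(* Let m(n, a) be the constant term of Y^a sigma_2(Y)^n. Multiplication by sigma_2 gives
   m(n + 1, a) = sum_(i < j) m(n, a + e_i + e_j), m is symmetric in a, and since the constant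
   term of X_1 d/dX_1 (...) is 0, applying this to (X_1 - X_1^-1) Y^a sigma_2^n gives a linear
   relation between the m(n, b) for each a. Modulo these relations, whose combinations have
   coefficients in Q(n), the eight moments with exponents 2, 11, 211, 1111, 222, 21111, 2222
   and 4 are closed under n |-> n + 1, so they satisfy a first-order system with explicit
   rational coefficients. As r(n + 1) = 10 m(n, 11), the recurrence becomes an identity between
   vectors of polynomials in n, checked by computation. The differential operator is the
   recurrence operator, composed with theta (theta - 1) ... (theta - 6) to remove the initial
   terms. *)

Require Import Defs.
From Stdlib Require Import ZArith.
From mathcomp Require Import all_boot all_order all_algebra.
From mathcomp Require Import perm ssrZ zify ring.
Import Order.TTheory GRing.Theory Num.Theory.
Local Open Scope ring_scope.

Set Implicit Arguments.
Unset Strict Implicit.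
Unset Printing Implicit Defensive.

Delimit Scope Z_scope with BZ.

(** * Moments of [sigma_2] *)

Definition incr (k : nat) (i : 'I_k) (a : {ffun 'I_k -> nat}) : {ffun 'I_k -> nat} :=
  [ffun j => ((i == j) + a j)%N].

Lemma incrC (k : nat) (i j : 'I_k) a : incr i (incr j a) = incr j (incr i a).
Proof. by apply/ffunP=> l; rewrite !ffunE addnCA. Qed.

Definition pair_sum (k : nat) (f : 'I_k -> 'I_k -> Z) : Z :=
  \sum_(i < k) \sum_(j < k | (i < j)%N) f i j.

Lemma eq_pair_sum k (f g : 'I_k -> 'I_k -> Z) :
  (forall i j : 'I_k, (i < j)%N -> f i j = g i j) -> pair_sum f = pair_sum g.
Proof. by move=> fg; apply: eq_bigr => i _; apply: eq_bigr => j; apply: fg. Qed.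

Lemma pair_sumD k (f g : 'I_k -> 'I_k -> Z) :
  pair_sum (fun i j => f i j + g i j) = pair_sum f + pair_sum g.
Proof. by rewrite -big_split; apply: eq_bigr => i _; rewrite big_split. Qed.

Lemma pair_sumZ k c (f : 'I_k -> 'I_k -> Z) :
  pair_sum (fun i j => c * f i j) = c * pair_sum f.
Proof. by rewrite mulr_sumr; apply: eq_bigr => i _; rewrite mulr_sumr. Qed.

(** In a pair i < j the index 0 can only come first. This isolates the pairs that change the
    exponent of Y_0 in [moment_stein]. *)
Lemma pair_sum_ord0 k (g : 'I_k.+1 -> 'I_k.+1 -> Z) :
  pair_sum (fun i j => (i == ord0)%:R * g i j) = \sum_(j | j != ord0) g ord0 j.
Proof.
rewrite /pair_sum (bigD1 ord0) //= [X in _ + X]big1 ?addr0.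
  apply: eq_big => [j|j _]; first by rewrite lt0n.
  by rewrite mul1r.
by move=> i /negPf ->; rewrite big1 // => j _; rewrite mul0r.
Qed.

(** A permutation does not preserve the condition i < j, but it preserves j != i. Symmetry is
    therefore proved on ordered pairs. *)
Lemma pair_sum_sym k (f : 'I_k -> 'I_k -> Z) : (forall i j, f i j = f j i) ->
  2 * pair_sum f = \sum_i \sum_(j | j != i) f i j.
Proof.
move=> fC.
have -> : \sum_i \sum_(j | j != i) f i j =
    pair_sum f + \sum_(i < k) \sum_(j < k | (j < i)%N) f i j.
  rewrite /pair_sum -big_split; apply: eq_bigr => i _ /=.
  rewrite (bigID (fun j : 'I_k => (i < j)%N)) /=.
  congr (_ + _); apply: eq_bigl => j; rewrite -val_eqE /=; lia.
rewrite (exchange_big_dep xpredT) //= mulr_natl mulr2n; congr (_ + _).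
by apply: eq_bigr => i _; apply: eq_bigr => j _; rewrite fC.
Qed.

Lemma pair_sum_perm k (f : 'I_k -> 'I_k -> Z) (s : {perm 'I_k}) :
  (forall i j, f i j = f j i) ->
  pair_sum (fun i j => f (s i) (s j)) = pair_sum f.
Proof.
move=> fC.
suff: 2 * pair_sum (fun i j => f (s i) (s j)) = 2 * pair_sum f by lia.
rewrite !pair_sum_sym //.
rewrite [RHS](reindex_inj (@perm_inj _ s)); apply: eq_bigr => i _.
rewrite [RHS](reindex_inj (@perm_inj _ s)); apply: eq_bigl => j.
by rewrite (inj_eq perm_inj).
Qed.

(* The coefficient of [X ^ (- x)] in [(X + X^-1) ^ k]. *)
Fixpoint walks (k : nat) (x : int) : Z :=
  if k is k'.+1 then walks k' (x + 1) + walks k' (x - 1) else (x == 0)%:R.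

Lemma walksS k x : walks k.+1 x = walks k (x + 1) + walks k (x - 1).
Proof. by []. Qed.

(* Applying [X d/dX] to [Y ^ k] gives [k (X - X^-1) Y ^ (k - 1)]. *)
Lemma walks_euler k x :
  x%:~R * walks k.+1 x = k.+1%:R * (walks k (x - 1) - walks k (x + 1)).
Proof.
elim: k x => [|k IH] x.
  rewrite /= mul1r; have [->|x1] := eqVneq x 1; first by vm_compute.
  have [->|x2] := eqVneq x (-1); first by vm_compute.
  have -> : (x - 1 == 0) = false by apply/negbTE; rewrite subr_eq0.
  have -> : (x + 1 == 0) = false by apply/negbTE; rewrite addr_eq0.
  by rewrite addr0 mulr0.
have := IH (x + 1); have := IH (x - 1).
rewrite (walksS k.+1) !(walksS k) !rmorphD !rmorphN rmorph1 ?addrK ?subrK.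
rewrite -[k.+2]addn1 -[k.+1]addn1 !natrD.
move: (walks k (x + 1 + 1)) (walks k x) (walks k (x - 1 - 1)) => A B C H1 H2.
have -> : x%:~R * (A + B + (B + C)) =
    ((x%:~R + 1) * (A + B)) - (A + B) + ((x%:~R + - 1) * (B + C) + (B + C)) :> Z by ring.
by rewrite H1 H2; ring.
Qed.

Lemma walksN k x : walks k (- x) = walks k x.
Proof.
elim: k x => [|k IH] x; first by rewrite /= oppr_eq0.
have E : - x + 1 = - (x - 1) by rewrite opprB addrC.
by rewrite !walksS E -opprD (IH (x - 1)) (IH (x + 1)) addrC.
Qed.

(** The recursion of the central binomial coefficients, which are the constant terms of even powers
    of Y. It follows from [walks_euler] at x = 1 and the symmetry x -> -x, and is the case n = 0 of
    [moment_stein]. *)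
Lemma walks0_rec k : k.+2%:R * walks k.+2 0 = 4 * k.+1%:R * walks k 0.
Proof.
have H := walks_euler k 1.
have E : walks k.+2 0 = 2 * walks k.+1 1.
  by rewrite walksS add0r sub0r walksN mulr_natl mulr2n.
have E1 : walks k.+1 1 = walks k (1 + 1) + walks k 0 by rewrite walksS subrr.
rewrite subrr mul1r E1 in H; rewrite E E1.
move: H; rewrite -[k.+2]addn1 -[k.+1]addn1 !natrD.
move: (walks k (1 + 1)) (walks k 0) => A B H.
have -> : (k%:R + 1 + 1) * (2 * (A + B)) = 2 * ((k%:R + 1) * (A + B) + (A + B)) :> Z by ring.
by rewrite {2}H; ring.
Qed.

Section Moments.
Variable k : nat.
Implicit Type a : {ffun 'I_k.+1 -> nat}.
Local Notation inc := (@incr k.+1).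

(* The constant term of [\prod_j Y_j ^ (a j) * sigma_2(Y) ^ n]. *)
Fixpoint moment (n : nat) a : Z :=
  if n is n'.+1 then pair_sum (fun i j => moment n' (inc i (inc j a)))
  else \prod_j walks (a j) 0.

Lemma moment_perm n a (s : {perm 'I_k.+1}) : moment n [ffun j => a (s j)] = moment n a.
Proof.
elim: n a => [|n IH] a /=.
  by rewrite [RHS](reindex_inj (@perm_inj _ s)); apply: eq_bigr => j _; rewrite ffunE.
rewrite -[RHS](pair_sum_perm s); last by move=> i j; rewrite incrC.
apply: eq_pair_sum => i j _; rewrite -[RHS]IH; congr (moment n _); apply/ffunP=> l.
by rewrite !(inj_eq perm_inj, ffunE).
Qed.

(** The predecessor truncates at 0. This is harmless in [moment_stein], where the term carries the
    factor [a ord0]. *)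
Definition decr0 a : {ffun 'I_k.+1 -> nat} :=
  [ffun j => if j == ord0 then (a j).-1 else a j].

Lemma decr0_incr0 a : decr0 (inc ord0 a) = a.
Proof. by apply/ffunP=> j; rewrite !ffunE; case: eqVneq. Qed.

Lemma incr0_decr0 a : (0 < a ord0)%N -> inc ord0 (decr0 a) = a.
Proof.
move=> a0; apply/ffunP=> j; rewrite !ffunE [ord0 == _]eq_sym.
by case: eqVneq => [->|//]; rewrite add1n prednK.
Qed.

Lemma decr0_incr i a : i != ord0 -> decr0 (inc i a) = inc i (decr0 a).
Proof.
move=> i0; apply/ffunP=> j; rewrite !ffunE.
by case: (eqVneq j) => // ->; rewrite (negPf i0).
Qed.

(** X_0 d/dX_0 maps sigma_2 to (X_0 - X_0^-1) times the sum of the Y_j with j != 0, and (X_0 -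
    X_0^-1)^2 = Y_0^2 - 4. The signs here are reversed. *)
Definition stein_sum n a : Z :=
  \sum_(j | j != ord0) (4 * moment n (inc j a) - moment n (inc j (inc ord0 (inc ord0 a)))).

(* The constant term of [X_0 d/dX_0 ((X_0 - X_0^-1) Y^a sigma_2(Y)^n)] vanishes. *)
Lemma moment_stein n a :
  4 * (a ord0)%:R * moment n (decr0 a) + n%:R * stein_sum n.-1 a =
  (a ord0).+1%:R * moment n (inc ord0 a).
Proof.
elim: n a => [|n IH] a.
  rewrite mul0r addr0 /= !(bigD1 (P := predT) ord0) //= !ffunE eqxx add1n.
  rewrite (eq_bigr (fun j => walks (a j) 0)); last first.
    by move=> j /negPf j0; rewrite ffunE j0.
  rewrite [in RHS](eq_bigr (fun j => walks (a j) 0)); last first.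
    by move=> j /negPf j0; rewrite ffunE eq_sym j0.
  rewrite !mulrA; congr (_ * _).
  (* For exponent 0 both sides vanish, since [walks 1 0] is 0. *)
  case: (a ord0) => [|m]; first by [].
  by rewrite [m.+1.-1]/= walks0_rec.
(* The relation for a at n + 1 comes from summing those for a + e_i + e_j at n. The pairs with i = 0
   change the coefficient [a ord0]. The resulting corrections in [E1] and [E2] differ by one copy of
   [stein_sum n a], which turns the factor n into n + 1. *)
pose g i j := inc i (inc j a).
have g0 (i j : 'I_k.+1) : (i < j)%N -> g i j ord0 = ((i == ord0) + a ord0)%N.
  by move=> ij; rewrite /g !ffunE (_ : j == ord0 = false) // -val_eqE /=; lia.
have j0 (i j : 'I_k.+1) : (i < j)%N -> j != ord0 by rewrite -val_eqE /=; lia.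
have E1 : pair_sum (fun i j => 4 * (g i j ord0)%:R * moment n (decr0 (g i j))) =
    4 * (a ord0)%:R * moment n.+1 (decr0 a) + \sum_(j | j != ord0) 4 * moment n (inc j a).
  rewrite /= -pair_sumZ -(pair_sum_ord0 (fun i j => 4 * moment n (inc j a))) -pair_sumD.
  apply: eq_pair_sum => i j ij; rewrite g0 // /g.
  have [->|i0] := eqVneq i ord0.
    rewrite decr0_incr0 natrD [true%:R]/=.
    case: (posnP (a ord0)) => [->|a0]; first by ring.
    by rewrite -(@decr0_incr j) ?(j0 _ _ ij) // incr0_decr0 ?ffunE; [ring|lia].
  by rewrite add0n mul0r addr0 !decr0_incr ?(j0 _ _ ij) // mulrA.
have E2 : pair_sum (fun i j => (g i j ord0).+1%:R * moment n (inc ord0 (g i j))) =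
    (a ord0).+1%:R * moment n.+1 (inc ord0 a) +
    \sum_(j | j != ord0) moment n (inc j (inc ord0 (inc ord0 a))).
  rewrite /= -pair_sumZ.
  rewrite -(pair_sum_ord0 (fun i j => moment n (inc j (inc ord0 (inc ord0 a))))) -pair_sumD.
  apply: eq_pair_sum => i j ij; rewrite g0 // /g.
  have -> : inc ord0 (inc i (inc j a)) = inc i (inc j (inc ord0 a)).
    by rewrite (incrC ord0 i) (incrC ord0 j).
  have [->|i0] := eqVneq i ord0; last by rewrite mul0r addr0.
  by rewrite (incrC ord0 j) -!natr1; ring.
have E3 : pair_sum (fun i j => n%:R * stein_sum n.-1 (g i j)) = n%:R * stein_sum n a.
  (* At n = 0 the level [n.-1] is truncated, but the factor n vanishes. *)
  case: n {IH E1 E2} => [|n]; first by rewrite pair_sumZ !mul0r.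
  rewrite pair_sumZ /stein_sum /=; congr (_ * _).
  rewrite /pair_sum.
  transitivity (\sum_(l | l != ord0) pair_sum (fun i j =>
      4 * moment n (inc l (g i j)) + (-1) * moment n (inc l (inc ord0 (inc ord0 (g i j)))))).
    rewrite exchange_big /=; apply: eq_bigr => i _.
    rewrite exchange_big /=; apply: eq_bigr => j _.
    by apply: eq_bigr => l _; rewrite mulN1r.
  apply: eq_bigr => l _; rewrite pair_sumD !pair_sumZ mulN1r.
  congr (4 * _ - _); apply: eq_pair_sum => i j _; rewrite /g.
    by rewrite (incrC l i) (incrC l j).
  by rewrite !(incrC ord0 i) !(incrC ord0 j) (incrC l i) (incrC l j).
have := eq_pair_sum (fun i j _ => IH (g i j)).
rewrite pair_sumD E1 E2 E3 [n.+1.-1]/= /stein_sum big_split /= sumrN -/(moment n.+1 _) => H.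
rewrite -addn1 natrD.
move: H; rewrite [n%:R * _]/=.
set S1 := \sum_(_ | _) _; set S2 := \sum_(_ | _) _ => H.
apply: (addIr S2); rewrite -H; ring.
Qed.

End Moments.

(** * Constant terms of Laurent polynomials *)

(* A Laurent polynomial seen as a linear functional on functions of the exponent. *)
Definition pairing (p : lpoly) (F : expo -> Z) : Z :=
  \sum_(t <- p) Z_of_int t.2 * F t.1.

(** [eadd] zips, so it truncates to the shorter exponent. Five coordinates survive only if both
    lists have length at least 5. *)
Definition size5 (p : lpoly) : bool := all (fun t => size t.1 == 5%N) p.

Lemma eq_pairing p F G : size5 p ->
  (forall e, size e = 5%N -> F e = G e) -> pairing p F = pairing p G.
Proof.
move=> /allP p5 FG; rewrite /pairing !big_seq; apply: eq_bigr => t tp.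
by rewrite FG //; apply/eqP/p5.
Qed.

Lemma pairing_sum (I : Type) (r : seq I) (P : pred I) p (F : I -> expo -> Z) :
  pairing p (fun e => \sum_(i <- r | P i) F i e) = \sum_(i <- r | P i) pairing p (F i).
Proof.
rewrite /pairing exchange_big; apply: eq_bigr => t _.
by rewrite mulr_sumr.
Qed.

Lemma pairing_lmul p q F :
  pairing (lmul p q) F = pairing q (fun f => pairing p (fun e => F (eadd e f))).
Proof.
rewrite /pairing /lmul big_allpairs_dep exchange_big; apply: eq_bigr => t _ /=.
by rewrite mulr_sumr; apply: eq_bigr => s _; rewrite rmorphM mulrAC mulrC mulrA.
Qed.

Lemma pairing_flatten (ps : seq lpoly) F :
  pairing (foldr ladd [::] ps) F = \sum_(p <- ps) pairing p F.
Proof.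
elim: ps => [|p ps IH]; first by rewrite /pairing !big_nil.
by rewrite big_cons -IH /pairing /ladd /= big_cat.
Qed.

Lemma eaddA e f g : eadd (eadd e f) g = eadd e (eadd f g).
Proof.
elim: e f g => [|x e IH] [|y f] [|z g] //.
by rewrite /eadd /= addrA; congr cons; exact: IH.
Qed.

Lemma size_eadd e f : size e = 5%N -> size f = 5%N -> size (eadd e f) = 5%N.
Proof. by move=> He Hf; rewrite size_map size_zip He Hf. Qed.

Lemma size5_lmul p q : size5 p -> size5 q -> size5 (lmul p q).
Proof.
move=> /allP p5 /allP q5; apply/allP=> _ /allpairsP[[s t] [sp tq ->]] /=.
by apply/eqP/size_eadd; apply/eqP; [exact: p5|exact: q5].
Qed.

Lemma size5_lpow_sigma2Y n : size5 (lpow sigma2Y n).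
Proof. by elim: n => [|n IH] //=; apply: size5_lmul. Qed.

(* [e |-> CT (X^e Y^a)] *)
Definition monomial_coef (a : {ffun 'I_5 -> nat}) (e : expo) : Z :=
  \prod_(j < 5) walks (a j) (nth 0 e j).

Lemma nth_eadd e f i : size e = 5%N -> size f = 5%N -> (i < 5)%N ->
  nth 0 (eadd e f) i = nth 0 e i + nth 0 f i.
Proof.
move=> He Hf i5; rewrite (nth_map (0, 0)) ?size_zip ?He ?Hf //.
by rewrite nth_zip ?He ?Hf.
Qed.

Lemma pairing_Y_def j F : pairing (Y j) F =
  F [seq (i == j)%:Z | i <- iota 0 5] + F [seq - (i == j)%:Z | i <- iota 0 5].
Proof.
rewrite /pairing !big_cons big_nil addr0.
by congr (_ + _); exact: mul1r.
Qed.

(** The two monomials of Y_j move coordinate j by 1 and -1, which is the recursion of [walks]. The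
    other factors stay fixed. *)
Lemma pairing_Y (j : 'I_5) a e : size e = 5%N ->
  pairing (Y j) (fun f => monomial_coef a (eadd f e)) = monomial_coef (incr j a) e.
Proof.
move=> He; rewrite pairing_Y_def /monomial_coef !(bigD1 (P := predT) j) //.
rewrite ffunE eqxx add1n walksS [RHS]mulrDl; congr (_ + _).
  congr (_ * _).
    by rewrite nth_eadd // (nth_map 0%N) ?size_iota // nth_iota // eqxx addrC.
  apply: eq_bigr => i /andP[_ ij]; rewrite ffunE [j == i]eq_sym (negPf ij) nth_eadd //.
  by rewrite (nth_map 0%N) ?size_iota // nth_iota // [(_ == _)%N](negPf ij) add0r.
congr (_ * _).
  by rewrite nth_eadd // (nth_map 0%N) ?size_iota // nth_iota // eqxx addrC.
apply: eq_bigr => i /andP[_ ij]; rewrite ffunE [j == i]eq_sym (negPf ij) nth_eadd //.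
by rewrite (nth_map 0%N) ?size_iota // nth_iota // [(_ == _)%N](negPf ij) oppr0 add0r.
Qed.

Lemma pairing_sigma2Y a e : size e = 5%N ->
  pairing sigma2Y (fun f => monomial_coef a (eadd f e)) =
  pair_sum (fun i j => monomial_coef (incr i (incr j a)) e).
Proof.
move=> He; rewrite pairing_flatten big_map big_filter big_mkcond big_allpairs_dep.
rewrite -[iota 0 5]/(index_iota 0 5) big_mkord; apply: eq_bigr => i _.
rewrite big_mkord -big_mkcond; apply: eq_bigr => j _.
rewrite pairing_lmul.
transitivity (pairing (Y j) (fun f => monomial_coef (incr i a) (eadd f e))).
  apply: eq_pairing => // f Hf; rewrite -pairing_Y; last exact: size_eadd.
  by apply: eq_pairing => // g Hg; rewrite eaddA.
by rewrite pairing_Y // incrC.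
Qed.

(** Each factor sigma_2 moves from the Laurent polynomial to the functional, where it raises
    exponents exactly as in [moment]. *)
Lemma pairing_lpow n a :
  pairing (lpow sigma2Y n) (monomial_coef a) = moment n a.
Proof.
elim: n a => [|n IH] a.
  rewrite /pairing big_seq1 mul1r /monomial_coef /=; apply: eq_bigr => j _.
  by rewrite nth_nseq ltn_ord.
rewrite [lpow _ _]/= pairing_lmul /=.
transitivity (pairing (lpow sigma2Y n)
    (fun f => pair_sum (fun i j => monomial_coef (incr i (incr j a)) f))).
  by apply: eq_pairing => [|f Hf]; [exact: size5_lpow_sigma2Y|exact: pairing_sigma2Y].
rewrite pairing_sum; apply: eq_bigr => i _.
by rewrite pairing_sum; apply: eq_bigr => j _; exact: IH.
Qed.

Lemma r25_moment n : r25 n = int_of_Z (moment n [ffun _ : 'I_5 => 0%N]).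
Proof.
rewrite -pairing_lpow /r25 /CT -[LHS]Z_of_intK; congr int_of_Z.
rewrite rmorph_sum big_mkcond.
transitivity (pairing (lpow sigma2Y n) (fun e => (e == ezero)%:R)).
  by apply: eq_bigr => t _; case: eqP => _; rewrite ?mulr1 ?mulr0.
apply: eq_pairing => [|e He]; first exact: size5_lpow_sigma2Y.
rewrite /monomial_coef; case: eqP => [->|ne].
  by rewrite big1 // => j _; rewrite ffunE nth_nseq ltn_ord.
(* A nonzero coordinate gives a factor [walks 0 _] equal to 0, so for a = 0 the functional is the
   indicator of [ezero]. *)
have [j ej] : exists j : 'I_5, nth 0 e j != 0.
  apply/existsP; rewrite -negb_forall; apply/negP => /forallP e0; apply: ne.
  apply: (@eq_from_nth _ 0) => [|i]; rewrite He // => i5.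
  by rewrite nth_nseq i5; apply/eqP; have := e0 (Ordinal i5).
by rewrite (bigD1 j) //= ffunE /= (negPf ej) mul0r.
Qed.

(** * Symbolic computation with moments *)

(** Coefficients are binary integers, constant term first, so that polynomial identities can be
    checked by evaluation. *)
Definition zpoly := seq Z.

Definition zeval (p : zpoly) (n : nat) : Z := foldr (fun c v => c + n%:R * v) 0 p.

Fixpoint zadd (p q : zpoly) : zpoly :=
  match p, q with
  | [::], _ => q
  | _, [::] => p
  | c :: p', d :: q' => Z.add c d :: zadd p' q'
  end.

Definition zmul (p q : zpoly) : zpoly :=
  foldr (fun c r => zadd (map (Z.mul c) q) (0%BZ :: r)) [::] p.

Definition zshift (k : nat) (p : zpoly) : zpoly :=
  foldr (fun c r => zadd [:: c] (zmul [:: Z.of_nat k; 1%BZ] r)) [::] p.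

(* Division of power series, truncated after [n] coefficients. *)
Fixpoint zdiv (n : nat) (p d : zpoly) : zpoly :=
  if n is n'.+1 then
    if p is c :: p' then
      let q := Z.div c (head 0%BZ d) in
      q :: zdiv n' (zadd p' (map (Z.mul (- q)) (behead d))) d
    else [::]
  else [::].

Lemma zeval_add p q n : zeval (zadd p q) n = zeval p n + zeval q n.
Proof.
elim: p q => [|c p IH] [|d q] /=; rewrite ?add0r ?addr0 //.
by rewrite IH; ring.
Qed.

Lemma zeval_const c n : zeval [:: c] n = c.
Proof. by rewrite /= mulr0 addr0. Qed.

Lemma zeval_scale c p n : zeval (map (Z.mul c) p) n = c * zeval p n.
Proof. by elim: p => [|d p IH] /=; rewrite ?mulr0 // IH; ring. Qed.

Lemma zeval_mul p q n : zeval (zmul p q) n = zeval p n * zeval q n.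
Proof.
elim: p => [|c p IH] /=; first by rewrite mul0r.
by rewrite zeval_add zeval_scale /= IH; ring.
Qed.

Lemma zeval_shift k p n : zeval (zshift k p) n = zeval p (n + k).
Proof.
elim: p => [|c p IH] //.
rewrite -[zshift k _]/(zadd [:: c] (zmul [:: Z.of_nat k; 1%BZ] (zshift k p))).
rewrite zeval_add zeval_mul IH /= natrD.
have -> : Z.of_nat k = k%:R by lia.
by ring.
Qed.

(** Positive coefficients make the denominator nonzero at every natural n, so that it can be
    cancelled. *)
Lemma zeval_gt0 p n : all (Z.ltb 0) p -> p != [::] -> (0 < zeval p n)%R.
Proof.
have E (c v : Z) : (0 < c)%R -> (0 <= v)%R -> (0 < c + n%:R * v)%R.
  by move=> c0 v0; rewrite ltr_wpDr // mulr_ge0 // ler0n.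
elim: p => [|c p IH] //= /andP[c0 p0] _; apply: E; first by lia.
by have [-> //|p1] := eqVneq p [::]; rewrite ltW // IH.
Qed.

(* The term [(c, l)] at level [N] stands for [c(n)] times the constant term of
   [Y^l * sigma_2(Y)^N]. *)
Definition form := seq (zpoly * seq nat).

Definition smoment (N : nat) (l : seq nat) : Z := moment N [ffun j : 'I_5 => nth 0%N l j].

(** The level [N] and the argument [n] are separate because the telescoping works at levels n + k
    with coefficients in n. *)
Definition feval (N n : nat) (f : form) : Z := \sum_(t <- f) zeval t.1 n * smoment N t.2.

Definition fscale (p : zpoly) (f : form) : form := [seq (zmul p t.1, t.2) | t <- f].

Lemma feval_cat N n f g : feval N n (f ++ g) = feval N n f + feval N n g.
Proof. by rewrite /feval big_cat. Qed.

Lemma feval_scale N n p f : feval N n (fscale p f) = zeval p n * feval N n f.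
Proof.
rewrite /feval big_map mulr_sumr; apply: eq_bigr => t _.
by rewrite zeval_mul mulrA.
Qed.

Lemma feval_flatten N n (T : Type) (s : seq T) (F : T -> form) :
  feval N n (flatten [seq F x | x <- s]) = \sum_(x <- s) feval N n (F x).
Proof.
elim: s => [|x s IH]; first by rewrite /feval !big_nil.
by rewrite /= feval_cat IH big_cons.
Qed.

(** The normal form of an exponent under the symmetry of the moments. The guard matters: sorting a
    longer list could bring an entry from beyond the fifth place among the first five, the only ones
    that [smoment] reads. *)
Definition sorted_exp (l : seq nat) : seq nat := if size l == 5%N then sort geq l else l.

Lemma smoment_sorted N l : smoment N (sorted_exp l) = smoment N l.
Proof.
rewrite /sorted_exp; case: eqP => // l5; rewrite /smoment.
have s5 : size (sort geq l) == 5%N by rewrite size_sort l5.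
have l5' : size l == 5%N by apply/eqP.
have /tuple_permP[s E] : perm_eq (Tuple s5) (Tuple l5').
  by rewrite perm_sort.
rewrite -[RHS](moment_perm _ _ s); congr moment; apply/ffunP=> j; rewrite !ffunE.
have -> : sort geq l = Tuple s5 by [].
by rewrite E -tnth_nth tnth_mktuple (tnth_nth 0%N).
Qed.

Fixpoint insert_term (c : zpoly) (l : seq nat) (f : form) : form :=
  if f is t :: f' then
    if t.2 == l then (zadd c t.1, l) :: f' else t :: insert_term c l f'
  else [:: (c, l)].

(** Like terms are merged and zero coefficients dropped, so an empty result certifies that a form
    evaluates to 0 for every n. *)
Definition collect (f : form) : form :=
  [seq t <- foldr (fun t => insert_term t.1 (sorted_exp t.2)) [::] f | ~~ all (Z.eqb 0) t.1].

Lemma feval_insert N n c l f :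
  feval N n (insert_term c l f) = zeval c n * smoment N l + feval N n f.
Proof.
elim: f => [|t f IH]; rewrite /feval /= ?big_cons ?big_nil //.
case: eqP => [<-|_]; rewrite !big_cons /=; first by rewrite zeval_add; ring.
by rewrite -!/(feval _ _ _) IH; ring.
Qed.

Lemma zeval_zero p n : all (Z.eqb 0) p -> zeval p n = 0.
Proof.
elim: p => [//|c p IH] /andP[/(proj1 (Z.eqb_eq 0 c)) <- /IH E].
by rewrite /= E mulr0 addr0.
Qed.

Lemma feval_collect N n f : feval N n (collect f) = feval N n f.
Proof.
rewrite /collect /feval big_filter big_mkcond /=.
transitivity (feval N n (foldr (fun t => insert_term t.1 (sorted_exp t.2)) [::] f)).
  apply: eq_bigr => t _; case: ifPn => // /negPn/zeval_zero ->.
  by rewrite mul0r.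
elim: f => [|t f IH]; first by rewrite /feval !big_nil.
by rewrite /= feval_insert smoment_sorted IH big_cons.
Qed.

Definition times_sigma2 (l : seq nat) : seq (seq nat) :=
  [seq incr_nth (incr_nth l ij.2) ij.1 |
     ij <- [seq (i, j) | i <- iota 0 5, j <- iota 0 5] & (ij.1 < ij.2)%N].

Lemma ffun_incr_nth (l : seq nat) (i : 'I_5) :
  [ffun j : 'I_5 => nth 0%N (incr_nth l i) j] = incr i [ffun j : 'I_5 => nth 0%N l j].
Proof. by apply/ffunP=> j; rewrite !ffunE nth_incr_nth. Qed.

Lemma smomentS N l : smoment N.+1 l = \sum_(m <- times_sigma2 l) smoment N m.
Proof.
rewrite /times_sigma2 big_map big_filter big_mkcond big_allpairs_dep.
rewrite -[iota 0 5]/(index_iota 0 5) big_mkord; apply: eq_bigr => i _.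
rewrite big_mkord -big_mkcond; apply: eq_bigr => j _ /=.
by rewrite /smoment !ffun_incr_nth.
Qed.

Definition fsigma2 (c : zpoly) (l : seq nat) : form := [seq (c, m) | m <- times_sigma2 l].

Lemma feval_sigma2 N n c l : feval N n (fsigma2 c l) = zeval c n * smoment N.+1 l.
Proof. by rewrite /feval big_map smomentS mulr_sumr. Qed.

(* [moment_stein] at level [n + 1], written at level [n]. *)
Definition stein (l : seq nat) : form :=
  let a := head 0%N l in let s := behead l in
  fsigma2 [:: (4 * Z.of_nat a)%BZ] (a.-1 :: s) ++
  fsigma2 [:: (- Z.of_nat a.+1)%BZ] (a.+1 :: s) ++
  flatten [seq [:: ([:: 4; 4]%BZ, incr_nth (a :: s) j);
                  ([:: -1; -1]%BZ, incr_nth (a.+2 :: s) j)] | j <- iota 1 4].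

Lemma feval_stein n l : feval n n (stein l) = 0.
Proof.
rewrite /stein; move: (head 0%N l) (behead l) => a s.
pose A := [ffun j : 'I_5 => nth 0%N (a :: s) j].
have dA : [ffun j : 'I_5 => nth 0%N (a.-1 :: s) j] = decr0 A.
  by apply/ffunP=> -[[|j] j5]; rewrite !ffunE.
have iA b : [ffun j : 'I_5 => nth 0%N (b.+1 :: s) j] =
    incr ord0 [ffun j : 'I_5 => nth 0%N (b :: s) j].
  by rewrite -ffun_incr_nth.
have sA : stein_sum n A = \sum_(i < 4)
    (4 * smoment n (incr_nth (a :: s) i.+1) - smoment n (incr_nth (a.+2 :: s) i.+1)).
  rewrite /stein_sum big_mkcond big_ord_recl /= add0r; apply: eq_bigr => i _.
  by rewrite -!iA -!ffun_incr_nth.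
have H := moment_stein n.+1 A; rewrite sA ffunE [nth _ _ _]/= -dA -iA in H.
rewrite 2!feval_cat !feval_sigma2 feval_flatten -[iota 1 4]/(index_iota 1 5) big_add1 big_mkord.
(* The coefficients [[:: 4; 4]] and [[:: -1; -1]] stand for 4(n + 1) and -(n + 1): the factor in
   front of the sum in [moment_stein] at level n + 1. *)
have -> : \sum_(i < 4) feval n n [:: ([:: 4; 4]%BZ, incr_nth (a :: s) i.+1);
                                 ([:: -1; -1]%BZ, incr_nth (a.+2 :: s) i.+1)] =
    n.+1%:R * \sum_(i < 4)
    (4 * smoment n (incr_nth (a :: s) i.+1) - smoment n (incr_nth (a.+2 :: s) i.+1)).
  rewrite mulr_sumr; apply: eq_bigr => i _.
  rewrite /feval !big_cons big_nil -natr1 /= !mulr0 !addr0.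
  have -> : (4 : Z)%BZ = 4%:R by []. have -> : (- 1 : Z)%BZ = - 1%:R by []. ring.
rewrite !zeval_const.
have -> : (- Z.of_nat a.+1)%BZ = - a.+1%:R by lia.
have -> : (4 * Z.of_nat a)%BZ = 4 * a%:R by lia.
by rewrite addrA addrAC [_ + n.+1%:R * _]H mulNr subrr.
Qed.

(** * Lowering the level by certified steps, and telescoping *)

Section Recurrence.
Variable den : zpoly.
Hypotheses (den_gt0 : all (Z.ltb 0) den) (den_neq0 : den != [::]).

(** A moment outside the table is expanded by sigma_2 alone, so a lookup is sound even if the table
    is not closed. *)
Definition lookup_step (steps : seq (seq nat * form)) (l : seq nat) : form :=
  head (fsigma2 den l) [seq s.2 | s <- steps & s.1 == l].

Lemma lookup_step_cons s steps l :
  lookup_step (s :: steps) l = if s.1 == l then s.2 else lookup_step steps l.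
Proof. by rewrite /lookup_step /=; case: eqP. Qed.

(* For the right [e] and [s], the exponents outside the table cancel; the result is sound
   whatever [e] and [s] are, hence no check. *)
Definition certified_step (c : seq nat * zpoly * form) : seq nat * form :=
  let: (l, e, s) := c in
  (l, collect (fsigma2 den l ++
        fscale (zmul [:: -1]%BZ e) (flatten [seq fscale t.1 (stein t.2) | t <- s]))).

Definition valid_steps (steps : seq (seq nat * form)) : Prop :=
  forall n l, feval n n (lookup_step steps l) = zeval den n * smoment n.+1 l.

Lemma certified_stepsP certs : valid_steps (map certified_step certs).
Proof.
move=> n l; elim: certs => [|[[l' e] s] certs IH]; first exact: feval_sigma2.
rewrite map_cons lookup_step_cons; case: eqP => [<-|_]; last exact: IH.
rewrite feval_collect feval_cat feval_sigma2 feval_scale feval_flatten.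
by rewrite big1 ?mulr0 ?addr0 // => t _; rewrite feval_scale feval_stein mulr0.
Qed.

Variable steps : seq (seq nat * form).
Hypothesis stepsP : valid_steps steps.

Definition shift_form (k : nat) (f : form) : form := [seq (zshift k t.1, t.2) | t <- f].

Lemma feval_shift N n k f : feval N n (shift_form k f) = feval N (n + k) f.
Proof. by rewrite /feval big_map; apply: eq_bigr => t _; rewrite zeval_shift. Qed.

(** One application of the first-order system, from level n + k + 1 to n + k. The steps are shifted
    because their coefficients are taken at n + k, those of [f] at n. *)
Definition lower_level (k : nat) (f : form) : form :=
  collect (flatten [seq fscale t.1 (shift_form k (lookup_step steps t.2)) | t <- f]).

Lemma feval_lower_level n k f : feval (n + k) n (lower_level k f) =
  zeval den (n + k) * feval (n + k).+1 n f.
Proof.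
rewrite feval_collect feval_flatten {2}/feval mulr_sumr; apply: eq_bigr => t _.
by rewrite feval_scale feval_shift stepsP mulrCA.
Qed.

(* Horner's scheme; the first component tells whether all the divisions were exact. *)
Fixpoint telescope (l : seq nat) (k : nat) (hs : seq zpoly) : bool * form :=
  if hs is h :: hs' then
    let: (b, f) := telescope l k.+1 hs' in
    let d := zshift k den in
    let g := lower_level k f in
    let q := [seq (zdiv (size t.1) t.1 d, t.2) | t <- g] in
    (b && nilp (collect (g ++ fscale (zmul [:: -1]%BZ d) q)), collect ((h, l) :: q))
  else (true, [::]).

(** The tail, which lives at level n + k + 1, is lowered to n + k and divided by [den] at n + k. The
    empty [collect] in the test certifies the quotient, whatever [zdiv] returns. *)
Lemma telescopeP n l k hs :
  let bf := telescope l k hs in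
  bf.1 -> feval (n + k) n bf.2 =
    \sum_(j < size hs) zeval (nth [::] hs j) n * smoment (n + k + j) l.
Proof.
elim: hs k => [|h hs IH] k /=; first by rewrite big_ord0 /feval big_nil.
case: (telescope l k.+1 hs) (IH k.+1) => b f /= E /andP[/E {}E /nilP g_eq].
set q := [seq (zdiv _ _ _, _) | t <- _] in g_eq *.
have: feval (n + k) n (collect (lower_level k f ++
    fscale (zmul [:: -1]%BZ (zshift k den)) q)) = 0.
  by rewrite g_eq /feval big_nil.
rewrite feval_collect feval_cat feval_scale feval_lower_level zeval_mul zeval_shift zeval_const.
have -> : (-1)%BZ = - 1 :> Z by [].
(* The test says that den(n + k) times the difference of tail and quotient is 0; positivity of [den]
   cancels the factor. *)
rewrite mulN1r mulNr -mulrBr => /eqP.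
rewrite mulf_eq0 gt_eqF ?zeval_gt0 // subr_eq0 => /eqP fq.
rewrite feval_collect /feval big_cons -/(feval _ _ _) -fq -addnS E big_ord_recl addn0.
congr (_ + _); apply: eq_bigr => j _.
by rewrite /= /bump leq0n add1n !addnS.
Qed.

End Recurrence.

(* [216 (n+2) (n+3)^3 (n+4)^3 (n+5)^2 (n+6)] *)
Definition denominator : zpoly :=
  [:: 111974400; 315394560; 394989696; 289814112; 138030912; 44606376; 9908568; 1494288; 146448;
      8424; 216]%BZ.

(* Obtained by solving linear systems over Q(n); one [certified_step] per moment of the system. *)
Definition certificates : seq (seq nat * zpoly * form) := [::
  ([:: 2; 0; 0; 0; 0]%N, [:: 37324800; 92689920; 100766592; 63015840; 25005024; 6533784; 1124928;
      123120; 7776; 216]%BZ,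
   [:: ([:: -1]%BZ, [:: 1; 0; 0; 0; 0]%N)]);
  ([:: 1; 1; 0; 0; 0]%N, [:: 55987200; 129703680; 132643008; 78585552; 29722680; 7441848; 1233360;
      130464; 7992; 216]%BZ,
   [:: ([:: -1]%BZ, [:: 0; 1; 0; 0; 0]%N)]);
  ([:: 2; 1; 1; 0; 0]%N, [:: 2073600; 3421440; 2401344; 929520; 214344; 29448; 2232; 72]%BZ,
   [:: ([:: -36; -12]%BZ, [:: 0; 1; 0; 0; 0]%N);
       ([:: -8; -12; -4]%BZ, [:: 0; 1; 1; 1; 0]%N);
       ([:: -18; -15; -3]%BZ, [:: 1; 1; 1; 0; 0]%N)]);
  ([:: 1; 1; 1; 1; 0]%N, [:: 37324800; 92689920; 100766592; 63015840; 25005024; 6533784; 1124928;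
      123120; 7776; 216]%BZ,
   [:: ([:: -2]%BZ, [:: 0; 1; 1; 1; 0]%N)]);
  ([:: 2; 2; 2; 0; 0]%N, [:: 450; 255; 48; 3]%BZ,
   [:: ([:: -2301696; -7353504; -7615296; -3768192; -984768; -131616; -7104]%BZ, [:: 0; 1; 0; 0;
       0]%N);
       ([:: -808704; -1891296; -1776816; -862080; -228768; -31584; -1776]%BZ, [:: 1; 0; 0; 0; 0]%N);
       ([:: -1804032; -3517344; -2818800; -1190448; -279744; -34704; -1776]%BZ, [:: 0; 2; 1; 0;
           0]%N);
       ([:: 535680; 1319184; 1223256; 560296; 135784; 16616; 800]%BZ, [:: 0; 1; 1; 1; 0]%N);
       ([:: -124416; -207360; -135648; -43632; -6912; -432]%BZ, [:: 1; 2; 0; 0; 0]%N);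
       ([:: 653184; 1069200; 690120; 221328; 35760; 2448; 24]%BZ, [:: 1; 1; 1; 0; 0]%N);
       ([:: -69984; -145800; -125388; -57024; -14472; -1944; -108]%BZ, [:: 0; 2; 2; 1; 0]%N);
       ([:: 7776; 18144; 16848; 7956; 2004; 252; 12]%BZ, [:: 0; 2; 1; 1; 1]%N);
       ([:: -93312; -186624; -153576; -66636; -16092; -2052; -108]%BZ, [:: 1; 2; 2; 0; 0]%N);
       ([:: 23328; 40824; 28188; 9612; 1620; 108]%BZ, [:: 1; 2; 1; 1; 0]%N);
       ([:: -1296; -2430; -1971; -912; -258; -42; -3]%BZ, [:: 1; 1; 1; 1; 1]%N)]);
  ([:: 2; 1; 1; 1; 1]%N, [:: 777600; 1347840; 991224; 400932; 96336; 13752; 1080; 36]%BZ,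
   [:: ([:: 288; 672; 192]%BZ, [:: 0; 1; 0; 0; 0]%N);
       ([:: 96; 144; 48]%BZ, [:: 1; 0; 0; 0; 0]%N);
       ([:: 288; 240; 48]%BZ, [:: 0; 2; 1; 0; 0]%N);
       ([:: -208; -264; -80]%BZ, [:: 0; 1; 1; 1; 0]%N);
       ([:: -144; -120; -24]%BZ, [:: 1; 1; 1; 0; 0]%N);
       ([:: -72; -60; -12]%BZ, [:: 0; 2; 1; 1; 1]%N);
       ([:: -18; -15; -3]%BZ, [:: 1; 1; 1; 1; 1]%N)]);
  ([:: 2; 2; 2; 2; 0]%N, [:: 1]%BZ,
   [:: ([:: -4135587840; -16848787968; -24544435968; -18833444352; -8739753984; -2593003008;
       -497048832; -59736576; -4101120; -122880]%BZ, [:: 0; 1; 0; 0; 0]%N);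
       ([:: -1519865856; -4694920704; -6164508672; -4548912768; -2089909248; -622301184;
           -120435456; -14640000; -1016064; -30720]%BZ, [:: 1; 0; 0; 0; 0]%N);
       ([:: -127401984; -307888128; -321159168; -188964864; -68616192; -15747072; -2230272;
           -178176; -6144]%BZ, [:: 0; 3; 0; 0; 0]%N);
       ([:: -5004509184; -13880844288; -17401112064; -13118973408; -6681751200; -2448277512;
           -669466344; -138945096; -21801768; -2512344; -199800; -9720; -216]%BZ, [:: 0; 2; 1; 0;
           0]%N);
       ([:: 1162377216; 3408562944; 3919237632; 2184971616; 453144832; -163216392; -149521552;
           -52777640; -11166576; -1520152; -131184; -6552; -144]%BZ, [:: 0; 1; 1; 1; 0]%N);
       ([:: -888827904; -2614436352; -3463699968; -2720314656; -1399732320; -490968984;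
           -117842136; -18695256; -1741080; -50184; 7224; 792; 24]%BZ, [:: 1; 2; 0; 0; 0]%N);
       ([:: 730073088; 1024503552; 74545920; -756622944; -700586208; -314055960; -80201928;
           -10642392; -97800; 210552; 34920; 2520; 72]%BZ, [:: 1; 1; 1; 0; 0]%N);
       ([:: 735547392; 2555670528; 4055774976; 3889367424; 2511235104; 1150469856; 383566920;
           93785472; 16691496; 2108448; 179352; 9216; 216]%BZ, [:: 2; 1; 0; 0; 0]%N);
       ([:: 329453568; 1076861952; 1600383744; 1431434304; 859254144; 365241648; 112955088;
           25673712; 4269840; 508560; 41328; 2064; 48]%BZ, [:: 3; 0; 0; 0; 0]%N);
       ([:: 692375040; 2237683968; 3284092512; 2897286624; 1713216456; 716231592; 217368072;
           48322944; 7821792; 900360; 70056; 3312; 72]%BZ, [:: 0; 4; 1; 0; 0]%N);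
       ([:: -73903104; -172440576; -150341184; -37659168; 36144792; 40252536; 19957086; 6145560;
           1260990; 173304; 15354; 792; 18]%BZ, [:: 0; 3; 2; 0; 0]%N);
       ([:: 278069760; 1074269952; 1864490400; 1925385120; 1319089896; 632126808; 217366092;
           54047232; 9642348; 1203048; 99540; 4896; 108]%BZ, [:: 0; 3; 1; 1; 0]%N);
       ([:: -297851904; -749948544; -804046176; -469053504; -152484120; -20547648; 3678048;
           2243016; 465480; 51696; 3024; 72]%BZ, [:: 0; 2; 2; 1; 0]%N);
       ([:: 46282752; 134307072; 169115040; 122505264; 57351528; 18670956; 4513224; 859644;
           131064; 14916; 1080; 36]%BZ, [:: 0; 2; 1; 1; 1]%N);
       ([:: 190978560; 518545152; 607691808; 393696864; 144701016; 22262664; -5169048; -3839664;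
           -1056432; -170616; -16920; -960; -24]%BZ, [:: 1; 4; 0; 0; 0]%N);
       ([:: 299718144; 896292864; 1198164960; 942905232; 483139584; 167713884; 39462714; 5984172;
           475146; -7164; -5778; -540; -18]%BZ, [:: 1; 3; 1; 0; 0]%N);
       ([:: -43296768; -84385152; -72674496; -48124152; -36825480; -26182890; -13236318; -4485834;
           -1015614; -151758; -14346; -774; -18]%BZ, [:: 1; 2; 2; 0; 0]%N);
       ([:: 55240704; 41212800; -124812576; -261088704; -238337496; -133656768; -50930532;
           -13704048; -2620116; -348768; -30636; -1584; -36]%BZ, [:: 1; 2; 1; 1; 0]%N);
       ([:: -20839680; -68084064; -102407328; -92894544; -55998840; -23375478; -6848112; -1399062;
           -193944; -17202; -864; -18]%BZ, [:: 1; 1; 1; 1; 1]%N);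
       ([:: -82114560; -314710272; -541769472; -555325200; -378258480; -180683244; -62152092;
           -15531732; -2801484; -356004; -30276; -1548; -36]%BZ, [:: 2; 3; 0; 0; 0]%N);
       ([:: -335923200; -1105933824; -1658403072; -1500029280; -912859416; -394362360; -124192170;
           -28763208; -4867146; -587160; -47934; -2376; -54]%BZ, [:: 2; 2; 1; 0; 0]%N);
       ([:: -137355264; -428737536; -606797568; -515809728; -293932080; -118610544; -34871652;
           -7556784; -1203444; -138000; -10860; -528; -12]%BZ, [:: 3; 2; 0; 0; 0]%N);
       ([:: -45722880; -157899456; -247731696; -233593524; -147499416; -65732823; -21207897;
           -4993191; -851715; -102681; -8307; -405; -9]%BZ, [:: 0; 4; 3; 0; 0]%N);
       ([:: -106375680; -316141056; -422073504; -334431504; -174885048; -63427212; -16294032;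
           -2967660; -375912; -31572; -1584; -36]%BZ, [:: 0; 4; 2; 1; 0]%N);
       ([:: -3732480; -13499136; -20979648; -18630864; -10535328; -3980844; -1020996; -175896;
           -19512; -1260; -36]%BZ, [:: 0; 4; 1; 1; 1]%N);
       ([:: -46656000; -187401600; -331607520; -344533608; -235335744; -111752622; -37934334;
           -9294102; -1633878; -201258; -16506; -810; -18]%BZ, [:: 0; 3; 3; 1; 0]%N);
       ([:: 27993600; 81181440; 104734944; 79185600; 38862504; 12938544; 2959704; 459360; 46296;
           2736; 72]%BZ, [:: 0; 3; 2; 2; 0]%N);
       ([:: -25194240; -71290368; -90718704; -68924520; -35030988; -12648114; -3354660; -661806;
           -95868; -9702; -612; -18]%BZ, [:: 0; 3; 2; 1; 1]%N);
       ([:: 11384064; 31570560; 38705040; 27562464; 12575268; 3814812; 769896; 99720; 7524;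
           252]%BZ, [:: 0; 2; 2; 2; 1]%N);
       ([:: 17262720; 70015104; 125354952; 132059268; 91675386; 44358291; 15387399; 3865185;
           699165; 88965; 7569; 387; 9]%BZ, [:: 1; 4; 2; 0; 0]%N);
       ([:: 62519040; 193684608; 270235440; 224282736; 123096276; 46933380; 12689928; 2434068;
           324684; 28692; 1512; 36]%BZ, [:: 1; 4; 1; 1; 0]%N);
       ([:: -36391680; -131616576; -214815888; -209442348; -135996840; -62015625; -20382183;
           -4868667; -839511; -101979; -8289; -405; -9]%BZ, [:: 1; 3; 3; 0; 0]%N);
       ([:: 15863040; 80466048; 164582928; 189632448; 140549220; 71566560; 25888734; 6741396;
           1259082; 164952; 14418; 756; 18]%BZ, [:: 1; 3; 2; 1; 0]%N);
       ([:: 18195840; 56827008; 80048088; 67116924; 37191474; 14283657; 3872646; 739359; 97074;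
           8307; 414; 9]%BZ, [:: 1; 3; 1; 1; 1]%N);
       ([:: -51321600; -141056640; -172055664; -122733360; -56732004; -17764164; -3817584;
           -556200; -52596; -2916; -72]%BZ, [:: 1; 2; 2; 2; 0]%N);
       ([:: -11384064; -37262592; -54490320; -46914984; -26356500; -10102446; -2677302; -484668;
           -57384; -4014; -126]%BZ, [:: 1; 2; 2; 1; 1]%N);
       ([:: 40590720; 123125184; 168033528; 136292544; 73050714; 27183888; 7170678; 1341558;
           174546; 15048; 774; 18]%BZ, [:: 2; 4; 1; 0; 0]%N);
       ([:: 23794560; 87340032; 145529784; 145603332; 97453854; 45983331; 15688647; 3900681;
           701577; 89037; 7569; 387; 9]%BZ, [:: 2; 3; 2; 0; 0]%N);
       ([:: -23328000; -70372800; -95430960; -76835844; -40832028; -15044283; -3922884; -724167;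
           -92772; -7857; -396; -9]%BZ, [:: 3; 3; 1; 0; 0]%N)]);
  ([:: 4; 0; 0; 0; 0]%N, [:: 311040; 373248; 176688; 41256; 4752; 216]%BZ,
   [:: ([:: -936; -2040; -1344; -352; -32]%BZ, [:: 0; 1; 0; 0; 0]%N);
       ([:: -384; -512; -248; -52; -4]%BZ, [:: 1; 0; 0; 0; 0]%N);
       ([:: 144; 204; 106; 24; 2]%BZ, [:: 0; 3; 0; 0; 0]%N);
       ([:: -432; -612; -318; -72; -6]%BZ, [:: 0; 2; 1; 0; 0]%N);
       ([:: 128; 264; 180; 48; 4]%BZ, [:: 0; 1; 1; 1; 0]%N);
       ([:: 180; 222; 90; 12]%BZ, [:: 1; 1; 1; 0; 0]%N);
       ([:: -72; -120; -74; -20; -2]%BZ, [:: 2; 1; 0; 0; 0]%N);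
       ([:: -72; -102; -53; -12; -1]%BZ, [:: 3; 0; 0; 0; 0]%N)])].

(* Fitted on the first terms of [r25]; this solution is unique up to a constant factor. *)
Definition recurrence_coefs : seq zpoly := [::
  [:: 42140738676326400000; 157842901249818624000; 257331505709737574400; 243764108399982673920;
      150397023447243816960; 63968341924254842880; 19301263998729584640; 4174508253346529280;
      643779101841162240; 69168932868587520; 4922454740828160; 208614614630400; 3986266521600];
  [:: 118427858324029440000; 355246559316108902400; 481552669599250186240; 390301079007991857152;
      210764527991633575936; 79918506618774847488; 21826970852964532224; 4327696049218387968;
      618429092691574784; 62134020238999552; 4167373533741056; 167578215383040; 3056137666560];
  [:: 62676619662919680000; 168213967990385049600; 205820392167964974080; 151791584110964534272;
      75137340688642841600; 26295232911598126080; 6670149766003083264; 1235525904487723008;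
      165841646014996480; 15729900132270080; 1000638108860416; 38329059901440; 668530114560];
  [:: 1794185247360768000; 4260839636091043840; 4649746903477813888; 3082953754682083328;
      1382952049413254272; 442032317052873728; 103190706316889344; 17720524544509952;
      2220812336954368; 198014286036992; 11919389769728; 434786795520; 7266631680];
  [:: -3522851180688416000; -8446568365407735680; -9248095565260356576; -6114775140268882576;
      -2719484985845017792; -857108315069629104; -196310820429867616; -32924151546376000;
      -4013146001886336; -346719870364160; -20154401039360; -707739648000; -11354112000];
  [:: -458904717778020000; -1056134626035848800; -1109896707061337856; -704344314090018780;
      -300647030233781612; -90944593157694708; -19993089019041540; -3218776240146608;
      -376681142235984; -31252297558272; -1745103671296; -58889994240; -908328960];
  [:: -1106658753555600; -2330306062592328; -2249741897564436; -1317143965540014;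
      -520970340108810; -146691130015168; -30156685922334; -4561556620082; -503951197636;
      -39663617640; -2111344496; -68259840; -1013760];
  [:: 836209651013100; 1823470291632528; 1811702917816029; 1084613257235718; 435833439807171;
      123860858052324; 25531982914119; 3847089898422; 420608699769; 32547074928; 1692297492;
      53095680; 760320]]%BZ.

(** * From the recurrence to the differential equation *)

Section RecurrenceToODE.
Variables (s d : nat) (h : nat -> {poly rat}) (F : fps).
Hypothesis size_h : forall j, (j <= s)%N -> size (h j) = d.+1.
Hypothesis h_rec : forall n, \sum_(j < s.+1) (h j).[n%:R] * F (n + j)%N = 0.

(* With [theta = z d/dz], the operator [z^(s-j) * ode_factor j (theta)] maps [F] to the
   sequence [m |-> m (m-1) ... (m-s+1) * h_j(m-s) * F (m-s+j)]: the falling factorial kills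
   the initial terms, where the recurrence says nothing. *)
Definition ode_factor (j : nat) : {poly rat} :=
  (h j \Po ('X - j%:R%:P)) * \prod_(l <- iota 0 s) ('X - (l%:R - (s - j)%:R)%:P).

Lemma size_ode_factor j : (j <= s)%N -> size (ode_factor j) = (d + s).+1.
Proof.
move=> js; rewrite size_Mmonic ?monic_prod_XsubC // -?size_poly_gt0.
  by rewrite size_prod_XsubC size_iota size_comp_poly2 ?size_XsubC // size_h // addnS.
by rewrite size_comp_poly2 ?size_XsubC // size_h.
Qed.

(** The factor z^i replaces m by m - i, and the shifts in [ode_factor] undo this. All terms thus
    share the argument m - s of the h_j and the same falling factorial. *)
Lemma ode_factor_eval m i : (i <= m)%N -> (i <= s)%N ->
  (ode_factor (s - i)).[(m - i)%:R] =
  (h (s - i)).[m%:R - s%:R] * \prod_(l <- iota 0 s) (m%:R - l%:R).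
Proof.
move=> im is_; rewrite hornerM horner_comp !hornerE natrB // natrB // subKn //.
congr (_.[_] * _); first by ring.
by rewrite horner_prod; apply: eq_bigr => l _; rewrite !hornerE; ring.
Qed.

(** The sum over e of z^e [ode_factor (s - e)] (theta), rearranged by powers of theta. *)
Definition ode_coef (k : 'I_(d + s).+1) : {poly rat} :=
  \poly_(e < s.+1) (ode_factor (s - e))`_k.

(** The coefficient of z^s is the leading coefficient of [ode_factor 0]. Its being nonzero makes
    both the order d + s and the degree s exact. *)
Lemma size_ode_coef_max : size (ode_coef ord_max) = s.+1.
Proof.
rewrite size_poly_eq // subnn /=.
have -> : (d + s)%N = (size (ode_factor 0)).-1 by rewrite size_ode_factor.
by rewrite -lead_coefE lead_coef_eq0 -size_poly_gt0 size_ode_factor.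
Qed.

Lemma iter_theta k (G : fps) n : iter k theta G n = n%:R ^+ k * G n.
Proof. by elim: k => [|k IH] /=; rewrite ?mul1r // /theta IH exprS mulrA. Qed.

Lemma diffop_degree_ode_coef : diffop_degree ode_coef = s.
Proof.
apply/eqP; rewrite eqn_leq; apply/andP; split.
  by apply/bigmax_leqP => k _; rewrite -subn1 leq_subLR add1n; exact: size_poly.
rewrite -[X in (X <= _)%N]/(s.+1.-1) -size_ode_coef_max.
exact: (leq_bigmax (F := fun k => (size (ode_coef k)).-1)).
Qed.

Lemma diffop_apply_ode_coef m : diffop_apply ode_coef F m = 0.
Proof.
have E (i : 'I_m.+1) : \sum_(k < (d + s).+1) (ode_coef k)`_i * iter k theta F (m - i)%N =
    if (i < s.+1)%N then (h (s - i)).[m%:R - s%:R] * F (m - i)%N *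
      \prod_(l <- iota 0 s) (m%:R - l%:R) else 0.
  case: ltnP => [is_|si]; last by rewrite big1 // => k _; rewrite coef_poly ltnNge si mul0r.
  have im : (i <= m)%N by rewrite -ltnS.
  rewrite mulrAC -(ode_factor_eval im is_) (horner_coef_wide (n := (d + s).+1)); last first.
    by rewrite size_ode_factor ?leq_subr.
  rewrite mulr_suml; apply: eq_bigr => k _.
  by rewrite coef_poly is_ iter_theta mulrA.
rewrite /diffop_apply /pmul exchange_big (eq_bigr _ (fun i _ => E i)) -big_mkcond -mulr_suml /=.
(* For m < s the falling factorial contains the factor m - m. *)
have [ms|sm] := ltnP m s.
  by rewrite (big_rem m) ?mem_iota //= subrr mul0r mulr0.
rewrite -(big_ord_widen_cond m.+1 xpredT
  (fun i => (h (s - i)).[m%:R - s%:R] * F (m - i)%N)) //.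
(* With j = s - i, the remaining sum is the recurrence at n = m - s. *)
rewrite (reindex_inj rev_ord_inj) /=.
rewrite -[X in X * _](_ : \sum_(j < s.+1) (h j).[(m - s)%:R] * F (m - s + j)%N = _).
  by rewrite h_rec mul0r.
apply: eq_bigr => j _; have js : (j <= s)%N by rewrite -ltnS.
by rewrite subSS subKn // natrB // subnA // -addnBAC.
Qed.

End RecurrenceToODE.

(** * The recurrence *)

(* The recurrence at [n + 1]; the factor 6 makes the quotients in [telescope] integral. *)
Definition shifted_coefs : seq zpoly := [seq zmul [:: 6]%BZ (zshift 1 h) | h <- recurrence_coefs].

(** The decisive computation: every division is exact and the combination of the m(n + j, 11)
    reduces to the empty form. *)
Lemma telescope_shifted_coefs :
  telescope denominator (map (certified_step denominator) certificates)
    [:: 1; 1; 0; 0; 0]%N 0 shifted_coefs = (true, [::]).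
Proof. by vm_cast_no_check (erefl (true, Nil (zpoly * seq nat))). Qed.

Definition recurrence_coef (j : nat) : zpoly := nth [::] recurrence_coefs j.

Definition zero_exp : seq nat := nseq 5 0%N.

Lemma smoment_zero_expS N : smoment N.+1 zero_exp = 10 * smoment N [:: 1; 1; 0; 0; 0]%N.
Proof.
transitivity (feval N 0 (collect (fsigma2 [:: 1%BZ] zero_exp))).
  by rewrite feval_collect feval_sigma2 zeval_const mul1r.
have -> : collect (fsigma2 [:: 1%BZ] zero_exp) = [:: ([:: 10%BZ], [:: 1; 1; 0; 0; 0]%N)].
  by vm_compute.
by rewrite /feval big_seq1 zeval_const.
Qed.

(** Every r(n + 1 + j) is 10 m(n + j, 11), so the telescoped identity applies; the auxiliary factor
    6 is cancelled in Z. *)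
Lemma recurrence_succ n :
  \sum_(j < 8) zeval (recurrence_coef j) n.+1 * smoment (n.+1 + j) zero_exp = 0.
Proof.
have stepsP := certified_stepsP denominator certificates.
have := @telescopeP denominator isT isT _ stepsP n [:: 1; 1; 0; 0; 0]%N 0 shifted_coefs.
rewrite telescope_shifted_coefs => /(_ isT); rewrite [LHS]big_nil => E.
suff: 6 * \sum_(j < 8) zeval (recurrence_coef j) n.+1 * smoment (n.+1 + j) zero_exp = 0 by lia.
transitivity (10 * \sum_(j < 8) zeval (nth [::] shifted_coefs j) n *
    smoment (n + 0 + j) [:: 1; 1; 0; 0; 0]%N); last by rewrite -[X in 10 * X]E mulr0.
rewrite !mulr_sumr; apply: eq_bigr => j _.
have -> : nth [::] shifted_coefs j = zmul [:: 6]%BZ (zshift 1 (recurrence_coef j)).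
  by apply: nth_map; exact: ltn_ord.
rewrite zeval_mul zeval_shift zeval_const addn1 addn0 addSn smoment_zero_expS.
have -> : 6%BZ = 6 :> Z by [].
by ring.
Qed.

(* [\sum_j h_j(0) * sigma_2^j] *)
Definition initial_form : form :=
  foldr (fun h f => collect ((h, zero_exp) :: flatten [seq fsigma2 t.1 t.2 | t <- f]))
    [::] recurrence_coefs.

(** At level 0 a moment is the product of the constant terms of powers of single Y_j, which can be
    computed directly. *)
Definition initial_value (f : form) : Z :=
  foldr (fun t v => zeval t.1 0 * foldr (fun k w => walks k 0 * w) 1 t.2 + v) 0 f.

Lemma feval_initial f : all (fun t => size t.2 == 5%N) f -> feval 0 0 f = initial_value f.
Proof.
elim: f => [|t f IH] /=; first by rewrite /feval big_nil.
case/andP=> /eqP t5 f5; rewrite /feval big_cons -/(feval _ _ _) IH //; congr (_ * _ + _).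
rewrite /smoment /= (eq_bigr (fun j : 'I_5 => walks (nth 0%N t.2 j) 0)); last first.
  by move=> j _; rewrite ffunE.
rewrite -(big_mkord xpredT (fun j => walks (nth 0%N t.2 j) 0)) -t5.
rewrite -(big_nth 0%N xpredT (walks^~ 0)).
by rewrite unlock.
Qed.

Lemma feval_horner N (hs : seq zpoly) l :
  feval N 0 (foldr (fun h f => collect ((h, l) :: flatten [seq fsigma2 t.1 t.2 | t <- f]))
    [::] hs) = \sum_(j < size hs) zeval (nth [::] hs j) 0 * smoment (N + j) l.
Proof.
elim: hs N => [|h hs IH] N; first by rewrite big_ord0 /feval big_nil.
rewrite [foldr _ _ _]/= feval_collect /feval big_cons -/(feval _ _ _) big_ord_recl addn0.
congr (_ + _); rewrite feval_flatten.
under eq_bigr => t _ do rewrite feval_sigma2.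
rewrite -/(feval N.+1 0 _) IH; apply: eq_bigr => j _.
by rewrite /= /bump leq0n add1n addnS.
Qed.

(** The term r(0) is not of the form 10 m(N, 11), so the case n = 0 is evaluated numerically. *)
Lemma recurrence_zero : \sum_(j < 8) zeval (recurrence_coef j) 0 * smoment j zero_exp = 0.
Proof.
transitivity (feval 0 0 initial_form); first by rewrite feval_horner.
rewrite feval_initial; last by vm_cast_no_check (erefl true).
by vm_cast_no_check (erefl Z0).
Qed.

(** * Transfer to integer polynomials and conclusion *)

Definition recurrence_poly (j : nat) : {poly int} := Poly [seq int_of_Z c | c <- recurrence_coef j].

Lemma recurrence_poly_eval j n :
  (recurrence_poly j).[n%:Z] = int_of_Z (zeval (recurrence_coef j) n).
Proof.
rewrite horner_Poly; elim: (recurrence_coef j) => [|c p IH] //=.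
by rewrite IH rmorphD rmorphM rmorph_nat addrC mulrC -natz.
Qed.

Lemma size_recurrence_poly j : (j < 8)%N -> size (recurrence_poly j) = 13%N.
Proof.
move=> j8.
have /allP/(_ (recurrence_coef j)) :
    all (fun p => (size p == 13%N) && (last 0 p != 0)) recurrence_coefs.
  by vm_compute.
rewrite mem_nth // => /(_ isT) /andP[/eqP p13 pn0].
rewrite /recurrence_poly (PolyK (c := 0)) ?size_map //.
by rewrite (last_map int_of_Z _ 0) raddf_eq0 //; exact: can_inj int_of_ZK.
Qed.

Lemma r25_smoment n : r25 n = int_of_Z (smoment n zero_exp).
Proof.
rewrite r25_moment /smoment; congr (int_of_Z (moment n _)); apply/ffunP=> j.
by rewrite !ffunE nth_nseq ltn_ord.
Qed.

Lemma r25_recurrence n : \sum_(j < 8) (recurrence_poly j).[n%:Z] * r25 (n + j) = 0.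
Proof.
have E : \sum_(j < 8) zeval (recurrence_coef j) n * smoment (n + j) zero_exp = 0.
  by case: n => [|n]; [exact: recurrence_zero | exact: recurrence_succ].
rewrite -[RHS](rmorph0 int_of_Z) -E rmorph_sum; apply: eq_bigr => j _.
by rewrite recurrence_poly_eval r25_smoment rmorphM.
Qed.

Theorem theorem9 :
  (exists h : 'I_8 -> {poly int},
      (forall j, (size (h j)).-1 = 12%N /\ h j != 0) /\
      (forall n : nat, \sum_(j < 8) (h j).[n%:Z] * r25 (n + j) = 0))
  /\
  (exists u : 'I_20 -> {poly rat},
      u ord_max != 0 /\ diffop_degree u = 7%N /\
      (forall m : nat, diffop_apply u R25 m = 0)).
Proof.
split.
  exists (fun j => recurrence_poly j); split; last exact: r25_recurrence.
  by move=> j; rewrite -size_poly_gt0 size_recurrence_poly.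
pose h j : {poly rat} := map_poly intr (recurrence_poly j).
have size_h j : (j <= 7)%N -> size (h j) = 13%N.
  by move=> j7; rewrite size_map_inj_poly ?size_recurrence_poly //; exact: intr_inj.
have h_rec n : \sum_(j < 8) (h j).[n%:R] * R25 (n + j)%N = 0.
  rewrite -[RHS](rmorph0 (intr : int -> rat)) -(r25_recurrence n) rmorph_sum.
  apply: eq_bigr => j _; rewrite rmorphM /R25 /=; congr (_ * _).
  by rewrite -horner_map /= -pmulrn.
(* The order is 19 = 12 + 7: the degree of the h_j plus the seven factors theta - l. *)
exists (@ode_coef 7 12 h); split; last split.
- by rewrite -size_poly_gt0 size_ode_coef_max.
- exact: (diffop_degree_ode_coef size_h).
- exact: (diffop_apply_ode_coef size_h h_rec).
Qed.
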